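(* Let $\Gamma\in\{G,W,O\}$, let $[\Gamma,\mathbb{B}]$ be the corresponding invariant line, and assume $\nu_\Gamma\le1$. Let $\mathbb{B}_0$ be the extension of the umbilic point on this line, and let $M$ be a state on the segment $[\mathbb{B}_0,\mathbb{B}]$. Then there are two states $\mathfrak{S},\mathcal{F}$ on the segment $[\Gamma,\mathcal{U}]$ such that for any state $U$ on the invariant line with $s_U\in(s_{\mathcal{F}},s_{\mathfrak{S}})$ there is an undercompressive shock (for the identity viscosity matrix) with left state $U$, right state $M$ and speed $\sigma(U;M)$; these states satisfy $$\sigma(\mathfrak{S};M)=\lambda_s(\mathfrak{S}),\qquad \sigma(\mathcal{F};M)=\lambda_f(\mathcal{F}).$$
   Context: Model. Let $\mu_w,\mu_o,\mu_g>0$ be the viscosities of water, oil, gas. Saturations are $s_w,s_o,s_g\ge 0$ with $s_w+s_o+s_g=1$; the saturation triangle is $\Omega=\{(s_w,s_o): s_w,s_o\ge0,\ s_w+s_o\le1\}$, with vertices $W,O,G$ where $s_w=1$, $s_o=1$, $s_g=1$ respectively. The flux is $F=(f_w,f_o)$ with $f_i=(s_i^2/\mu_i)/(\sum_{j\in\{w,o,g\}}s_j^2/\mu_j)$, and the system is $U_t+F(U)_x=0$, $U=(s_w,s_o)^T$. Denote by $\lambda_s(U)\le\lambda_f(U)$ the (slow and fast) eigenvalues of $DF(U)$. The umbilic point, where $\lambda_s=\lambda_f$, is $\mathcal{U}$ with $(s_w,s_o,s_g)=(\mu_w,\mu_o,\mu_g)/(\mu_w+\mu_o+\mu_g)$.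 Invariant lines. For $\Gamma\in\{G,W,O\}$ let $\gamma$ be the corresponding phase ($g,w,o$) and $\alpha,\beta$ the other two phases. Put $\nu_\Gamma=(\mu_\alpha+\mu_\beta)/\mu_\gamma$. The invariant line $[\Gamma,\mathbb{B}]$ is the set of states with $s_\alpha/\mu_\alpha=s_\beta/\mu_\beta$; it is parametrized by the effective saturation $s=s_\alpha+s_\beta\in[0,1]$, with $s=0$ at the vertex $\Gamma$ and $s=1$ at the point $\mathbb{B}$ on the opposite edge ($\mathbb{B}$ is named $D,E,B$ for $\Gamma=G,W,O$). For a state $M$ on this line, $s_M$ denotes its effective saturation; $s_{\mathcal{U}}=\nu_\Gamma/(1+\nu_\Gamma)$. Intervals such as $[\mathbb{B}_0,\mathbb{B}]$ denote segments of the line. With $E(s)=s^2+\nu_\Gamma(1-s)^2$, the eigenvalues of $DF$ along the line are $\lambda_a(s)=2s/E(s)$ and $\lambda_b(s)=2\nu_\Gamma s(1-s)/E(s)^2$, and $\lambda_s=\min\{\lambda_a,\lambda_b\}$, $\lambda_f=\max\{\lambda_a,\lambda_b\}$. The Rankine-Hugoniot speed $\sigma(M;N)$ between two states of the line (i.e. $F(N)-F(M)=\sigma(N-M)$) is $\sigma(M;N)=\nu_\Gamma(s_M+s_N-2s_Ms_N)/(E(s_M)E(s_N))$; this formula is also used to define $\sigma(M;N)$ when $M=N$. The extension $\mathbb{B}_0$ of the umbilic point is the state of the line with $\sigma(\mathbb{B}_0;\mathcal{U})=\lambda_s(\mathcal{U})=\lambda_f(\mathcal{U})=2$ given by $s_{\mathbb{B}_0}=1/2$.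 Undercompressive shock (identity viscosity matrix). An undercompressive shock from left state $U^-$ to right state $U^+$ with speed $\sigma$ is a discontinuity satisfying $F(U^+)-F(U^-)=\sigma(U^+-U^-)$, for which $\lambda_s(U^\pm)<\sigma<\lambda_f(U^\pm)$ (so that $U^-$, $U^+$ are saddles of the ODE below), and having a viscous profile, i.e. there is an orbit of $\dot U=F(U)-F(U^-)-\sigma(U-U^-)$ going from $U^-$ (as time $\to-\infty$) to $U^+$ (as time $\to+\infty$). *)

(* Defs.v *)
From HB Require Import structures.
From mathcomp Require Import all_boot all_order all_algebra.
From mathcomp Require Import all_classical all_reals all_analysis.

Set Implicit Arguments.
Unset Strict Implicit.
Unset Printing Implicit Defensive.

Import Order.TTheory GRing.Theory Num.Theory.
Import numFieldNormedType.Exports.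

Local Open Scope classical_set_scope.
Local Open Scope ring_scope.

(* Phases also index the vertices W, O, G of the saturation triangle. *)
Variant phase := water | oil | gas.

Definition same_phase (i j : phase) : bool :=
  match i, j with
  | water, water | oil, oil | gas, gas => true
  | _, _ => false
  end.

Definition others (G : phase) : phase * phase :=
  match G with
  | gas => (water, oil)
  | water => (oil, gas)
  | oil => (water, gas)
  end.

Section Model.
Context {R : realType}.
Implicit Types (mu : phase -> R) (U M N X : 'rV[R]_2) (G : phase).

(* A state is the row vector (s_w, s_o). *)
Definition coord_phase (k : 'I_2) : phase := if k == 0 then water else oil.

Definition sat U (i : phase) : R :=
  match i with
  | water => U 0 0
  | oil => U 0 1
  | gas => 1 - U 0 0 - U 0 1
  end.

Definition Omega : set 'rV[R]_2 := [set U | forall i, 0 <= sat U i].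

Definition mobility mu U (i : phase) : R := sat U i ^+ 2 / mu i.

Definition frac_flow mu U (i : phase) : R :=
  mobility mu U i /
  (mobility mu U water + mobility mu U oil + mobility mu U gas).

(* The same formula is smooth on the whole plane, which gives a meaning to the
   Jacobian of the flux on the boundary of the triangle. *)
Definition flux mu U : 'rV[R]_2 := \row_k frac_flow mu U (coord_phase k).

(* Smallest and largest eigenvalue of the Jacobian of the flux (the set of
   eigenvalues is finite, so [inf] and [sup] are a min and a max). The library
   Jacobian acts on row vectors, i.e. it is the transpose of the usual one. *)
Definition lambda_s mu U : R := inf [set a | eigenvalue ('J (flux mu) U) a].
Definition lambda_f mu U : R := sup [set a | eigenvalue ('J (flux mu) U) a].

Definition umbilic mu : 'rV[R]_2 :=
  \row_k (mu (coord_phase k) / (mu water + mu oil + mu gas)).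

Definition nu mu G : R := (mu (others G).1 + mu (others G).2) / mu G.

Definition invariant_line mu G : set 'rV[R]_2 :=
  [set U | Omega U /\ sat U (others G).1 / mu (others G).1 =
                      sat U (others G).2 / mu (others G).2].

Definition eff_sat G U : R := sat U (others G).1 + sat U (others G).2.

(* The state of the invariant line with effective saturation [s]. *)
Definition line_state mu G (s : R) : 'rV[R]_2 :=
  \row_k (if same_phase (coord_phase k) G then 1 - s
          else s * (mu (coord_phase k) / (mu (others G).1 + mu (others G).2))).

Definition vertex mu G := line_state mu G 0.
Definition edge_point mu G := line_state mu G 1.
Definition umbilic_ext mu G := line_state mu G 2^-1.

(* The segment [M, N] of the invariant line, for s_M <= s_N. *)
Definition line_segment mu G M N : set 'rV[R]_2 :=
  [set X | invariant_line mu G X /\ eff_sat G M <= eff_sat G X <= eff_sat G N].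

(* The Rankine-Hugoniot speed between two states of the invariant line, extended
   to M = N by the same formula. *)
Definition Efun (n s : R) : R := s ^+ 2 + n * (1 - s) ^+ 2.

Definition sigma mu G M N : R :=
  let n := nu mu G in let sM := eff_sat G M in let sN := eff_sat G N in
  n * (sM + sN - 2 * sM * sN) / (Efun n sM * Efun n sN).

(* An orbit, within the saturation triangle, of the travelling wave equation
   for the identity viscosity matrix. *)
Definition viscous_profile mu (UL UR : 'rV[R]_2) (c : R) (phi : R -> 'rV[R]_2) : Prop :=
  [/\ forall t, Omega (phi t),
      forall t : R, is_derive t (1 : R) phi
        (flux mu (phi t) - flux mu UL - c *: (phi t - UL)),
      phi t @[t --> -oo] --> UL
    & phi t @[t --> +oo] --> UR].

Record undercompressive_shock mu (UL UR : 'rV[R]_2) (c : R) : Prop := UndercompressiveShock {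
  shock_left_state : Omega UL;
  shock_right_state : Omega UR;
  shock_jump : UL <> UR;
  shock_RH : flux mu UR - flux mu UL = c *: (UR - UL);
  shock_left_saddle : lambda_s mu UL < c < lambda_f mu UL;
  shock_right_saddle : lambda_s mu UR < c < lambda_f mu UR;
  shock_profile : exists phi, viscous_profile mu UL UR c phi
}.

End Model.

(* Main.v *)
Require Import Defs.
From HB Require Import structures.
From mathcomp Require Import all_boot all_order all_algebra.
From mathcomp Require Import all_classical all_reals all_analysis.
From mathcomp Require Import ring lra.

Import Order.TTheory GRing.Theory Num.Theory.
Import numFieldNormedType.Exports.

Local Open Scope classical_set_scope.
Local Open Scope ring_scope.

Set Implicit Arguments.
Unset Strict Implicit.
Unset Printing Implicit Defensive.

(** On an invariant line the system reduces to the scalar law with flux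
    [f s = s ^+ 2 / Efun n s], where [n] is [nu mu G]: the states of the line are
    mapped into the line by [flux], and an orbit of the travelling wave equation
    that starts on the line stays there. The flux Jacobian at a state of the line
    has two explicit eigenvectors, the direction of the line, with eigenvalue
    [lam_line n s], the derivative of [f], and a transverse direction with
    eigenvalue [lam_trans n s] ([line_state_eigenvalues]). Before the umbilic
    point, at [s = n / (1 + n)], the transverse eigenvalue is the slow one.

    Fix the effective saturation [m >= 1 / 2] of the right state. The speed of the
    shock from [s] to [m] is the slope [chord n s m] of a chord of the graph of
    [f]. It exceeds [lam_trans n s] exactly when [s] is below the explicit value
    [slow_sat n m]; it is less than [lam_line n s] exactly when [tangency n s m]
    is positive. Since [tangency] increases with [s], this happens beyond the
    zero of [fast_sat_exists], where the chord is tangent to the graph. These two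
    values of [s] define the states S and F, and between them the left state is a
    saddle. The graph of [f] is convex and then concave, so a chord to [m] that
    lies below the tangent at [s] is steeper than the graph at [m]
    ([tangency_swap]); together with [chord_lt_lam_trans], which uses [n <= 1],
    the right state is a saddle too.

    The profile is an orbit on the line joining [s] to [m]. The scalar equation
    has a rational right-hand side whose numerator has the simple zeros [s] and
    [m] and no zero in between, the third factor being affine and positive at both
    ends. Its orbit is obtained by inverting the explicit time function, a sum of
    logarithms ([heteroclinic_orbit], [line_orbit]). *)

(** * Speeds along an invariant line *)

Section LineSpeeds.
Context {R : realType}.

(** The line is invariant because [flux] maps the state with effective
    saturation [s] to the one with effective saturation [eff_flux n s]
    ([flux_line_state]). *)
Definition eff_flux (n s : R) : R := s ^+ 2 / Efun n s.
(** The eigenvalues of the flux Jacobian at a state of the line: [lam_trans] for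
    the direction that exchanges the two phases other than that of the vertex,
    [lam_line], the derivative of [eff_flux n], for the direction of the line. *)
Definition lam_trans (n s : R) : R := 2 * s / Efun n s.
Definition lam_line (n s : R) : R := 2 * n * s * (1 - s) / Efun n s ^+ 2.

(** The minimum over [s] is attained at [n / (1 + n)], the effective saturation
    of the umbilic point. *)
Lemma Efun_ge (n s : R) : 0 < n -> n / (1 + n) <= Efun n s.
Proof.
move=> n0; rewrite ler_pdivrMr ?addr_gt0// -subr_ge0.
have -> : Efun n s * (1 + n) - n = ((1 + n) * s - n) ^+ 2 by rewrite /Efun; ring.
exact: sqr_ge0.
Qed.

Lemma Efun_gt0 (n s : R) : 0 < n -> 0 < Efun n s.
Proof.
by move=> n0; apply: lt_le_trans (Efun_ge s n0); rewrite divr_gt0// addr_gt0.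
Qed.

(** The slope of the chord of [eff_flux n] between [s] and [m], i.e. the
    Rankine-Hugoniot speed. *)
Definition chord (n s m : R) : R :=
  n * (s + m - 2 * s * m) / (Efun n s * Efun n m).

(** What remains of [lam_line n s - chord n s m] once the trivial root [s = m]
    and positive factors are divided out: its zero in [s] is the point where the
    chord to [m] is tangent to the graph of [eff_flux n]. *)
Definition tangency (n s m : R) : R := (1 + n) * s * (s + 2 * m * (1 - s)) - n.

Lemma chordC (n s m : R) : chord n s m = chord n m s.
Proof. by rewrite /chord [Efun n s * _]mulrC; congr (_ / _); ring. Qed.

Lemma eff_fluxB (n s m : R) : 0 < n ->
  eff_flux n m - eff_flux n s = chord n s m * (m - s).
Proof.
move=> n0; have := Efun_gt0 s n0; have := Efun_gt0 m n0.
by rewrite /eff_flux /chord /Efun => ? ?; field; lra.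
Qed.

Lemma lam_line_chord (n s m : R) : 0 < n ->
  lam_line n s - chord n s m =
  n * (m - s) * tangency n s m / (Efun n s ^+ 2 * Efun n m).
Proof.
move=> n0; have := Efun_gt0 s n0; have := Efun_gt0 m n0.
by rewrite /lam_line /chord /tangency /Efun => ? ?; field; lra.
Qed.

(** Once the denominators are cleared, [chord n s m = lam_trans n s] is linear
    in [s]; this is its root. *)
Definition slow_sat (n m : R) : R := n * m / (2 * Efun n m + 2 * n * m - n).

Lemma slow_denom_gt0 (n m : R) : 0 < n -> 2^-1 <= m ->
  0 < 2 * Efun n m + 2 * n * m - n.
Proof.
move=> n0 m1.
have -> : 2 * Efun n m + 2 * n * m - n =
  2 * m ^+ 2 + n * (m ^+ 2 + (1 - m) ^+ 2).
  by rewrite /Efun; ring.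
by rewrite ltr_wpDr ?mulr_gt0 ?exprn_gt0 ?mulr_ge0 ?addr_ge0 ?sqr_ge0 ?ltW//; lra.
Qed.

Lemma chord_lam_trans (n s m : R) : 0 < n -> 2^-1 <= m ->
  chord n s m - lam_trans n s =
  (slow_sat n m - s) * (2 * Efun n m + 2 * n * m - n) / (Efun n s * Efun n m).
Proof.
move=> n0 m1; have := Efun_gt0 s n0; have := Efun_gt0 m n0.
have := slow_denom_gt0 n0 m1; rewrite /chord /lam_trans /slow_sat.
set D := _ - n => D0 Em Es; have DE : D = 2 * Efun n m + 2 * n * m - n by [].
by rewrite mulrBl divfK ?gt_eqF// DE; field; lra.
Qed.

(** The root lies before the umbilic point since the difference is a positive
    multiple of [(2 * m - 1) * (m * (1 + n) - n)]; both factors are nonnegative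
    because [m >= 1 / 2 >= n / (1 + n)]. *)
Lemma slow_sat_le (n m : R) : 0 < n -> n <= 1 -> 2^-1 <= m <= 1 ->
  0 <= slow_sat n m <= n / (1 + n).
Proof.
move=> n0 n1 /andP[m1 m2]; have D0 := slow_denom_gt0 n0 m1.
apply/andP; split; first by rewrite divr_ge0 ?mulr_ge0 ?ltW//; lra.
rewrite ler_pdivrMr// mulrAC ler_pdivlMr ?addr_gt0//.
rewrite -subr_ge0 (_ : _ - _ = n * ((2 * m - 1) * (m * (1 + n) - n))); last first.
  by rewrite /Efun; ring.
by apply: mulr_ge0; [exact: ltW | apply: mulr_ge0]; nra.
Qed.

Lemma tangency_mono (n m s t : R) : 0 < n -> 0 < m <= 1 -> 0 <= s -> s < t ->
  t <= 1 -> tangency n s m < tangency n t m.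
Proof.
move=> n0 /andP[m0 m1] s0 st t1; rewrite -subr_gt0.
have -> : tangency n t m - tangency n s m =
  (1 + n) * ((t - s) * (m * (1 - s) + (m * (1 - t) + (s + t) * (1 - m)))).
  by rewrite /tangency; ring.
have ms : 0 < m * (1 - s) by apply: mulr_gt0; lra.
have mt : 0 <= m * (1 - t) by apply: mulr_ge0; lra.
have sm : 0 <= (s + t) * (1 - m) by apply: mulr_ge0; lra.
by apply: mulr_gt0; [lra | apply: mulr_gt0; lra].
Qed.

(** The tangency function is [- n] at the vertex, and at the umbilic point it
    has the sign of [2 * m - 1]. *)
Lemma fast_sat_exists (n m : R) : 0 < n -> n <= 1 -> 2^-1 <= m <= 1 ->
  exists2 s, 0 <= s <= n / (1 + n) & tangency n s m = 0.
Proof.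
move=> n0 n1 /andP[m1 m2]; pose k := n / (1 + n).
have k0 : 0 <= k by rewrite divr_ge0 ?addr_ge0 ?ltW.
have [||c ck tc] := IVT (f := fun s => tangency n s m) (v := 0) k0.
- apply: continuous_subspaceT => s; rewrite /tangency.
  apply: cvgB; last exact: cvg_cst.
  apply: cvgM; first by apply: cvgMr; exact: cvg_id.
  by apply: cvgD; [|apply: cvgMr; apply: cvgB; [exact: cvg_cst|]]; exact: cvg_id.
- rewrite ge_min le_max /tangency; apply/andP; split; apply/orP; [left|right].
    nra.
  have -> : (1 + n) * k * (k + 2 * m * (1 - k)) - n = n * (2 * m - 1) / (1 + n).
    by rewrite /k; field; lra.
  by rewrite divr_ge0 ?mulr_ge0//; lra.
- by exists c => //; move: ck; rewrite in_itv.
Qed.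

(** The numerator of the difference is affine in [n] and [0 < n <= 1], so it is an
    interpolation between its values at [n = 0] and [n = 1],
    which are nonnegative and positive respectively. *)
Lemma chord_lt_lam_trans (n s m : R) : 0 < n -> n <= 1 -> 2^-1 <= m <= 1 -> s < 2^-1 ->
  chord n s m < lam_trans n m.
Proof.
move=> n0 n1 /andP[m1 m2] s1; have Em := Efun_gt0 m n0; have Es := Efun_gt0 s n0.
rewrite -subr_gt0 /chord /lam_trans.
have -> : 2 * m / Efun n m - n * (s + m - 2 * s * m) / (Efun n s * Efun n m) =
  (2 * m * Efun n s - n * (s + m - 2 * s * m)) / (Efun n s * Efun n m) by field; lra.
rewrite divr_gt0 ?mulr_gt0//.
have -> : 2 * m * Efun n s - n * (s + m - 2 * s * m) =
  (1 - n) * (2 * m * s ^+ 2) +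
  n * (2 * (s - 2^-1) ^+ 2 + (m - 2^-1) * ((2 * s - 2^-1) ^+ 2 + 3 / 4)).
  by rewrite /Efun; field.
apply: ltr_wpDl; first by apply: mulr_ge0; [lra | rewrite mulr_ge0 ?sqr_ge0//; lra].
apply: mulr_gt0 => //; apply: ltr_pwDl.
  by rewrite mulr_gt0// exprn_even_gt0//= subr_eq0 lt_eqF.
by apply: mulr_ge0; [lra | rewrite addr_ge0 ?sqr_ge0//; lra].
Qed.

Lemma lam_trans_le_line (n s : R) : 0 < n -> s <= n / (1 + n) ->
  lam_trans n s <= lam_line n s.
Proof.
move=> n0; rewrite ler_pdivlMr ?addr_gt0// => sn.
have E0 := Efun_gt0 s n0.
rewrite -subr_ge0.
have -> : lam_line n s - lam_trans n s =
  2 * s ^+ 2 * (n - s * (1 + n)) / Efun n s ^+ 2.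
  by move: E0; rewrite /lam_line /lam_trans /Efun => E0; field; lra.
by rewrite divr_ge0 ?sqr_ge0// mulr_ge0 ?subr_ge0// mulr_ge0 ?sqr_ge0.
Qed.

Lemma lam_trans_lt_chord (n s m : R) : 0 < n -> 2^-1 <= m ->
  s < slow_sat n m -> lam_trans n s < chord n s m.
Proof.
move=> n0 m1 s_slow; rewrite -subr_gt0 chord_lam_trans//.
apply: divr_gt0; last by apply: mulr_gt0; exact: Efun_gt0.
by apply: mulr_gt0; [rewrite subr_gt0 | exact: slow_denom_gt0].
Qed.

Lemma chord_lt_lam_line (n s m : R) : 0 < n -> s < m ->
  0 < tangency n s m -> chord n s m < lam_line n s.
Proof.
move=> n0 sm T0; rewrite -subr_gt0 lam_line_chord//.
have Es := Efun_gt0 s n0; have Em := Efun_gt0 m n0.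
apply: divr_gt0; last by rewrite mulr_gt0// exprn_gt0.
by rewrite mulr_gt0// mulr_gt0// subr_gt0.
Qed.

Lemma lam_line_lt_chord (n s m : R) : 0 < n -> s < m ->
  0 < tangency n m s -> lam_line n m < chord n s m.
Proof.
move=> n0 sm T0; rewrite chordC -subr_lt0 lam_line_chord//.
have Es := Efun_gt0 s n0; have Em := Efun_gt0 m n0.
rewrite -opprB mulrN !mulNr oppr_lt0.
apply: divr_gt0; last by rewrite mulr_gt0// exprn_gt0.
by rewrite mulr_gt0// mulr_gt0// subr_gt0.
Qed.

(** Algebraic form of a consequence of [eff_flux n] being convex, then concave: if
    its graph is steeper than the chord at the left end, then the chord is steeper
    than the graph at the right end. *)
Lemma tangency_swap (n s m : R) : 0 < n -> 0 <= s <= 1 -> 0 <= m <= 1 -> s <= m ->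
  tangency n s m <= tangency n m s.
Proof.
move=> n0 /andP[s0 s1] /andP[m0 m1] sm; rewrite -subr_ge0.
have -> : tangency n m s - tangency n s m =
  (1 + n) * ((m - s) * (m * (1 - s) + s * (1 - m))).
  by rewrite /tangency; ring.
apply: mulr_ge0; first by lra.
by apply: mulr_ge0; [lra | rewrite addr_ge0// mulr_ge0//; lra].
Qed.

End LineSpeeds.

(** * Eigenvalues of the flux Jacobian *)

Section EffectiveFlux.
Context {R : realType}.
Implicit Types (mu : phase -> R) (U V : 'rV[R]_2) (G i : phase).

Lemma ord2_case (P : 'I_2 -> Prop) : P 0 -> P 1 -> forall k, P k.
Proof.
move=> P0 P1 k; have [->|->]// : k = 0 \/ k = 1.
by case: k => [[|[|]]]// p; [left|right]; apply/val_inj.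
Qed.

(** Two independent eigenvectors leave no room for a third eigenvalue. They are
    row vectors because ['J] acts on the right of row vectors: its row eigenvectors
    are the eigenvectors of the differential. *)
Lemma mx2_eigenvalues (F : fieldType) (J : 'M[F]_2) (u v : 'rV[F]_2) (a b : F) :
  u *m J = a *: u -> v *m J = b *: v ->
  u 0 0 * v 0 1 - u 0 1 * v 0 0 != 0 ->
  forall c, eigenvalue J c <-> c = a \/ c = b.
Proof.
move=> uJ vJ uv c; set det := _ - _ in uv; split; last first.
  by case=> ->; apply/eigenvalueP; [exists u | exists v]=> //;
    apply: contra_neq uv => z; rewrite /det z !mxE; ring.
move=> /eigenvalueP[w wJ w0].
pose x := (w 0 0 * v 0 1 - w 0 1 * v 0 0) / det.
pose y := (u 0 0 * w 0 1 - u 0 1 * w 0 0) / det.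
have wE : w = x *: u + y *: v.
  by apply/rowP; apply: ord2_case; rewrite !mxE /x /y /det; field.
clearbody x y.
have : x * (a - c) = 0 /\ y * (b - c) = 0.
  have E : (x * (a - c)) *: u + (y * (b - c)) *: v = 0.
    move: wJ; rewrite wE mulmxDl -!scalemxAl uJ vJ => /eqP.
    rewrite -subr_eq0 => /eqP <-; apply/rowP => k; rewrite !mxE; ring.
  have E0 := congr1 (fun z : 'rV_2 => z 0 0) E.
  have E1 := congr1 (fun z : 'rV_2 => z 0 1) E.
  move: E0 E1; rewrite !mxE => E0 E1.
  split; apply: (mulIf uv); rewrite mul0r /det.
    transitivity ((x * (a - c) * u 0 0 + y * (b - c) * v 0 0) * v 0 1 -
      (x * (a - c) * u 0 1 + y * (b - c) * v 0 1) * v 0 0); first by ring.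
    by rewrite E0 E1; ring.
  transitivity ((x * (a - c) * u 0 1 + y * (b - c) * v 0 1) * u 0 0 -
      (x * (a - c) * u 0 0 + y * (b - c) * v 0 0) * u 0 1); first by ring.
  by rewrite E0 E1; ring.
case=> /eqP + /eqP; rewrite !mulf_eq0 !subr_eq0.
move=> /orP[/eqP x0|/eqP<-]; last by left.
move=> /orP[/eqP y0|/eqP<-]; last by right.
by move: w0; rewrite wE x0 y0 !scale0r addr0 eqxx.
Qed.

Definition total_mobility mu U :=
  mobility mu U water + mobility mu U oil + mobility mu U gas.

Lemma total_mobility_gt0 mu U : (forall i, 0 < mu i) -> 0 < total_mobility mu U.
Proof.
move=> mu0; rewrite lt_neqAle eq_sym; apply/andP; split; last first.
  by rewrite !addr_ge0// divr_ge0 ?sqr_ge0// ltW.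
have m0 i : 0 <= mobility mu U i by rewrite divr_ge0 ?sqr_ge0// ltW.
have sat0 i : mobility mu U i = 0 -> sat U i = 0.
  move=> /eqP; rewrite mulf_eq0 invr_eq0 (gt_eqF (mu0 i)) orbF expf_eq0.
  by move=> /andP[_ /eqP].
apply/negP; rewrite !paddr_eq0 ?addr_ge0//.
move=> /andP[/andP[/eqP/sat0 w0 /eqP/sat0 o0] /eqP/sat0]; rewrite /sat in w0 o0 *.
by rewrite w0 o0; lra.
Qed.

(** The derivative of [sat ^~ i] in the direction [V]; there is no base point
    because the saturations are affine functions of the state. *)
Definition dsat (V : 'rV[R]_2) (i : phase) : R :=
  match i with
  | water => V 0 0
  | oil => V 0 1
  | gas => - V 0 0 - V 0 1
  end.

Lemma differentiable_sat i U : differentiable (fun X => sat X i) U.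
Proof.
case: i => /=.
- exact: differentiable_coord.
- exact: differentiable_coord.
- apply: differentiableB; last exact: differentiable_coord.
  by apply: differentiableB; [exact: differentiable_cst|exact: differentiable_coord].
Qed.

Lemma is_derive_coord V U (k : 'I_2) : is_derive U V (fun X : 'rV[R]_2 => X 0 k) (V 0 k).
Proof.
apply: DeriveDef; first exact/diff_derivable/differentiable_coord.
rewrite deriveE; last exact: differentiable_coord.
have lin : linear (fun X : 'rV[R]_2 => X 0 k : R) by move=> c x y; rewrite !mxE.
pose fM := GRing.isLinear.Build _ _ _ _ _ lin.
pose fL : {linear _ -> _} := HB.pack (fun X : 'rV[R]_2 => X 0 k : R) fM.
by rewrite (diff_lin (f := fL))//; exact: coord_continuous.
Qed.

Lemma is_derive_sat i V U : is_derive U V (fun X => sat X i) (dsat V i).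
Proof.
case: i => /=.
- exact: is_derive_coord.
- exact: is_derive_coord.
- apply: (is_derive_eq (is_deriveB
    (is_deriveB (is_derive_cst (1 : R) U V) (is_derive_coord V U 0))
    (is_derive_coord V U 1))).
  by rewrite sub0r.
Qed.

Definition dmobility mu U V i := 2 * sat U i * dsat V i / mu i.
Definition dtotal_mobility mu U V :=
  dmobility mu U V water + dmobility mu U V oil + dmobility mu U V gas.

Lemma is_derive_mobility mu i V U :
  is_derive U V (fun X => mobility mu X i) (dmobility mu U V i).
Proof.
rewrite (_ : (fun X => _) = (mu i)^-1 *: (fun X => sat X i) ^+ 2); last first.
  by apply/funext => X; rewrite /mobility mulrC.
apply: (is_derive_eq (is_deriveZ _ (is_deriveX _ (is_derive_sat i V U)))).
by rewrite /dmobility /GRing.scale/= expr1; ring.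
Qed.

Lemma is_derive_frac_flow mu i V U : (forall i, 0 < mu i) ->
  is_derive U V (fun X => frac_flow mu X i)
    (dmobility mu U V i / total_mobility mu U -
     mobility mu U i * dtotal_mobility mu U V / total_mobility mu U ^+ 2).
Proof.
move=> mu0; have := total_mobility_gt0 U mu0 => T0.
have Tne : total_mobility mu U != 0 by rewrite gt_eqF.
have Td : is_derive U V (total_mobility mu) (dtotal_mobility mu U V).
  by apply: is_deriveD; [apply: is_deriveD|]; exact: is_derive_mobility.
have Vd : is_derive U V (fun X => (total_mobility mu X)^-1)
   (- total_mobility mu U ^- 2 *: dtotal_mobility mu U V).
  apply: DeriveDef; first by apply: derivableV.
  by rewrite deriveV// derive_val.
apply: (is_derive_eq (is_deriveM (is_derive_mobility mu i V U) Vd)).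
by rewrite /GRing.scale/=; field.
Qed.

Lemma differentiable_flux mu U : (forall i, 0 < mu i) -> differentiable (flux mu) U.
Proof.
move=> mu0.
have dm i : differentiable (fun X => mobility mu X i) U.
  rewrite (_ : (fun X => _) = (mu i)^-1 *: (fun X => sat X i) ^+ 2); last first.
    by apply/funext => X; rewrite /mobility mulrC.
  by apply/differentiableZ/differentiableX/differentiable_sat.
have dT : differentiable (fun X => (total_mobility mu X)^-1) U.
  apply: differentiableV; last by rewrite gt_eqF// total_mobility_gt0.
  by apply: differentiableD => //; apply: differentiableD.
have df i : differentiable (fun X => frac_flow mu X i) U.
  exact: (differentiableM (dm i) dT).
rewrite (_ : flux mu = (fun X => frac_flow mu X water *: delta_mx 0 0) +
                       (fun X => frac_flow mu X oil *: delta_mx 0 1)); last first.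
  apply/funext => X; apply/rowP => k; rewrite !mxE/=.
  by case: k => [[|[|]]]// p; rewrite /coord_phase/=; ring.
by apply: differentiableD; apply: differentiableZl.
Qed.

Lemma nu_gt0 mu G : (forall i, 0 < mu i) -> 0 < nu mu G.
Proof. by move=> mu0; rewrite divr_gt0 ?addr_gt0. Qed.

Lemma sat_line_state mu G s i : (forall i, 0 < mu i) ->
  sat (line_state mu G s) i =
  if same_phase i G then 1 - s
  else s * (mu i / (mu (others G).1 + mu (others G).2)).
Proof.
move=> mu0; have := mu0 water; have := mu0 oil; have := mu0 gas.
by case: G; case: i; rewrite /= ?mxE/= => *; try field; lra.
Qed.

Lemma eff_sat_line_state mu G s : (forall i, 0 < mu i) ->
  eff_sat G (line_state mu G s) = s.
Proof.
move=> mu0; rewrite /eff_sat !sat_line_state//.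
have := mu0 water; have := mu0 oil; have := mu0 gas.
by case: G => /= *; field; lra.
Qed.

Lemma line_state_affine mu G s :
  line_state mu G s = vertex mu G + s *: (edge_point mu G - vertex mu G).
Proof. by apply/rowP => k; rewrite !mxE; case: ifP => _; ring. Qed.

Lemma Omega_line_state mu G s : (forall i, 0 < mu i) -> 0 <= s <= 1 ->
  Omega (line_state mu G s).
Proof.
move=> mu0 /andP[s0 s1] i /=; rewrite sat_line_state//; case: ifP => _.
  by rewrite subr_ge0.
by rewrite mulr_ge0// divr_ge0 ?addr_ge0 ?ltW.
Qed.

Lemma invariant_line_state mu G s : (forall i, 0 < mu i) -> 0 <= s <= 1 ->
  invariant_line mu G (line_state mu G s).
Proof.
move=> mu0 s01; split; first exact: Omega_line_state.
rewrite !sat_line_state//.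
have := mu0 water; have := mu0 oil; have := mu0 gas.
by case: G => /= *; field; lra.
Qed.

Lemma eff_sat_bounds G U : Omega U -> 0 <= eff_sat G U <= 1.
Proof.
move=> OU; have := OU water; have := OU oil; have := OU gas.
by rewrite /eff_sat; case: G => /= *; lra.
Qed.

Lemma line_state_eff_sat mu G U : (forall i, 0 < mu i) ->
  invariant_line mu G U -> line_state mu G (eff_sat G U) = U.
Proof.
move=> mu0 [_].
have := mu0 water; have := mu0 oil; have := mu0 gas => g0 o0 w0 /eqP.
rewrite eqr_div ?lt0r_neq0 ?mu0// => /eqP E.
have divE (x y z : R) : 0 < z -> x = y * z -> x / z = y.
  by move=> z0 ->; rewrite mulfK// gt_eqF.
apply/rowP; apply: ord2_case; move: E; rewrite /eff_sat !mxE;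
  case: G => /= E; rewrite ?mulrA; (try lra); apply: divE; lra.
Qed.

Lemma eff_sat_umbilic mu G : (forall i, 0 < mu i) ->
  eff_sat G (umbilic mu) = nu mu G / (1 + nu mu G).
Proof.
move=> mu0; have := mu0 water; have := mu0 oil; have := mu0 gas => g0 o0 w0.
by rewrite /eff_sat /nu; case: G; rewrite /= !mxE/= /coord_phase/=; field; lra.
Qed.

Lemma total_mobility_line_state mu G s : (forall i, 0 < mu i) ->
  total_mobility mu (line_state mu G s) =
  Efun (nu mu G) s / (mu (others G).1 + mu (others G).2).
Proof.
move=> mu0; have := mu0 water; have := mu0 oil; have := mu0 gas => g0 o0 w0.
rewrite /total_mobility /mobility !sat_line_state//.
by rewrite /Efun /nu; case: G => /=; field; lra.
Qed.

Lemma mobility_line_state mu G s i : (forall i, 0 < mu i) ->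
  mobility mu (line_state mu G s) i =
  if same_phase i G then (1 - s) ^+ 2 / mu G
  else s ^+ 2 * (mu i / (mu (others G).1 + mu (others G).2) ^+ 2).
Proof.
move=> mu0; have := mu0 water; have := mu0 oil; have := mu0 gas => g0 o0 w0.
by rewrite /mobility !sat_line_state//; case: G; case: i => /=; field; lra.
Qed.

Lemma flux_line_state mu G s : (forall i, 0 < mu i) ->
  flux mu (line_state mu G s) = line_state mu G (eff_flux (nu mu G) s).
Proof.
move=> mu0; have := mu0 water; have := mu0 oil; have := mu0 gas => g0 o0 w0.
have E0 := Efun_gt0 s (nu_gt0 G mu0).
apply/rowP => k; rewrite !mxE /frac_flow -/(total_mobility _ _).
rewrite total_mobility_line_state// mobility_line_state// /eff_flux.
case: ifP => kG; last by field; move: E0; case: {kG} G => /= *; lra.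
have -> : 1 - s ^+ 2 / Efun (nu mu G) s = nu mu G * (1 - s) ^+ 2 / Efun (nu mu G) s.
  apply/eqP; rewrite subr_eq -mulrDl addrC -/(Efun _ _) divff//.
  by rewrite gt_eqF.
move: E0; set E := Efun _ _ => E0; rewrite /nu; field.
by have := mu0 (others G).1; have := mu0 (others G).2; have := mu0 G; lra.
Qed.

(** Moving along this vector keeps the saturation of phase [G] and exchanges the
    two others; on the invariant line it leaves the total mobility stationary,
    which makes it an eigenvector. *)
Definition transverse_dir G : 'rV[R]_2 :=
  \row_k (if same_phase (coord_phase k) G then 0
          else if same_phase (coord_phase k) (others G).1 then 1 else - 1).

(** The quotient rule for [mobility / total_mobility], with denominators cleared,
    turns the eigenvector equation into one identity per phase, which treats the
    three vertices alike. *)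
Lemma jacobian_flux mu U V (c : R) : (forall i, 0 < mu i) ->
  (forall i, dmobility mu U V i * total_mobility mu U -
             mobility mu U i * dtotal_mobility mu U V =
             c * dsat V i * total_mobility mu U ^+ 2) ->
  V *m 'J (flux mu) U = c *: V.
Proof.
move=> mu0 H; have df := differentiable_flux U mu0.
have T0 : total_mobility mu U != 0 by rewrite gt_eqF// total_mobility_gt0.
rewrite -deriveEjacobian// derive_mx; last exact: diff_derivable.
apply/rowP => k; rewrite !mxE.
rewrite (_ : (fun X => flux mu X 0 k) = fun X => frac_flow mu X (coord_phase k));
  last by apply/funext => X; rewrite mxE.
have -> : V 0 k = dsat V (coord_phase k) by move: k; apply: ord2_case.
rewrite (@derive_val _ _ _ _ _ _ _ (is_derive_frac_flow (coord_phase k) V U mu0)).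
apply: (mulIf (expf_neq0 2 T0)); rewrite -H; by field.
Qed.

Lemma dsat_transverse_dir G i :
  dsat (transverse_dir G) i =
  if same_phase i G then 0 else if same_phase i (others G).1 then 1 else - 1.
Proof. by case: G; case: i; rewrite /= ?mxE/=; ring. Qed.

Lemma dsat_line_dir mu G i : (forall i, 0 < mu i) ->
  dsat (edge_point mu G - vertex mu G) i =
  if same_phase i G then -1 else mu i / (mu (others G).1 + mu (others G).2).
Proof.
move=> mu0; have := mu0 water; have := mu0 oil; have := mu0 gas => g0 o0 w0.
by case: G; case: i; rewrite /= ?mxE/=; (try field); lra.
Qed.

Lemma line_state_eigenvalues mu G s : (forall i, 0 < mu i) ->
  forall c, eigenvalue ('J (flux mu) (line_state mu G s)) c <->
    c = lam_trans (nu mu G) s \/ c = lam_line (nu mu G) s.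
Proof.
move=> mu0; have E0 := Efun_gt0 s (nu_gt0 G mu0).
have := mu0 water; have := mu0 oil; have := mu0 gas => g0 o0 w0.
have a0 := mu0 (others G).1; have b0 := mu0 (others G).2; have c0 := mu0 G.
apply: (@mx2_eigenvalues _ _ (transverse_dir G) (edge_point mu G - vertex mu G)).
- apply: jacobian_flux => // i.
  rewrite /dtotal_mobility /dmobility !dsat_transverse_dir !sat_line_state//.
  rewrite mobility_line_state// total_mobility_line_state// /lam_trans.
  move: E0 a0 b0 c0; set E := Efun _ _ => E0.
  by case: G @E E0; case: i => /= E E0 *; field; lra.
- apply: jacobian_flux => // i.
  rewrite /dtotal_mobility /dmobility !dsat_line_dir// !sat_line_state//.
  rewrite mobility_line_state// total_mobility_line_state// /lam_line.
  have E1 : 0 < s ^+ 2 * mu G + (mu (others G).1 + mu (others G).2) * (1 - s) ^+ 2.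
    have <- : Efun (nu mu G) s * mu G = s ^+ 2 * mu G +
      (mu (others G).1 + mu (others G).2) * (1 - s) ^+ 2.
      by rewrite /Efun /nu; field; lra.
    exact: mulr_gt0.
  move: E1 a0 b0 c0; rewrite /Efun /nu.
  by case: G {E0}; case: i => /= E1 *; field; lra.
- rewrite (_ : _ - _ = if G is oil then -1 else 1).
    by case: G {E0 a0 b0 c0}; rewrite ?oppr_eq0 oner_neq0.
  by rewrite !mxE; case: G {E0 a0 b0 c0}; rewrite /= /coord_phase/=; field; lra.
Qed.

Lemma lambda_line_state mu G s : (forall i, 0 < mu i) ->
  lambda_s mu (line_state mu G s) =
    Num.min (lam_trans (nu mu G) s) (lam_line (nu mu G) s) /\
  lambda_f mu (line_state mu G s) =
    Num.max (lam_trans (nu mu G) s) (lam_line (nu mu G) s).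
Proof.
move=> mu0; rewrite /lambda_s /lambda_f; set a := lam_trans _ _; set b := lam_line _ _.
have -> : [set c | eigenvalue ('J (flux mu) (line_state mu G s)) c] = [set a; b].
  by apply/seteqP; split => c /line_state_eigenvalues; exact.
have infsup (x y : R) : x <= y -> inf [set x; y] = x /\ sup [set x; y] = y.
  move=> xy; split.
    by rewrite (inf_setU (has_inf1 x)) ?inf1// => ? ? -> ->.
  by rewrite (sup_setU (has_sup1 y)) ?sup1// => ? ? -> ->.
have [ab|ba] := leP a b; first exact: infsup.
by rewrite setUC; apply/infsup/ltW.
Qed.

End EffectiveFlux.

(** * Heteroclinic orbits of a scalar equation *)

(** The clock [Th] is an increasing bijection of the line because its rate is
    bounded away from [0]; its inverse solves [u' = 1 / k u]. *)
Lemma inverse_clock (R : realType) (Th k : R -> R) (d : R) :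
  0 < d -> (forall u : R, is_derive u 1 Th (k u)) -> (forall u, d <= k u) ->
  exists tau : R -> R,
    [/\ forall t : R, is_derive t 1 tau (k (tau t))^-1,
        tau t @[t --> -oo] --> -oo & tau t @[t --> +oo] --> +oo].
Proof.
move=> d0 Thd kd.
have Thc : continuous Th.
  by move=> u; apply/differentiable_continuous/derivable1_diffP; case: (Thd u).
have growth (u v : R) : u <= v -> d * (v - u) <= Th v - Th u.
  rewrite le_eqVlt => /predU1P[->|uv]; first by rewrite !subrr mulr0.
  have [c _ ->] := MVT uv (fun x _ => Thd x) (continuous_subspaceT Thc).
  by rewrite ler_wpM2r// subr_ge0 ltW.
have mono (u v : R) : u < v -> Th u < Th v.
  move=> uv; rewrite -subr_gt0; apply: lt_le_trans (growth _ _ (ltW uv)).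
  by rewrite mulr_gt0// subr_gt0.
have surj (t : R) : exists u, Th u = t.
  pose r := `|t - Th 0| / d.
  have r0 : 0 <= r by rewrite divr_ge0// ltW.
  have dr : d * r = `|t - Th 0| by rewrite /r mulrCA divff ?gt_eqF// mulr1.
  have hi : t <= Th r.
    have := growth _ _ r0; rewrite subr0 dr.
    by have := ler_norm (t - Th 0); lra.
  have lo : Th (- r) <= t.
    have Nr0 : - r <= 0 by rewrite oppr_le0.
    have := growth _ _ Nr0; rewrite sub0r opprK dr.
    by have := lerNnormlW (lexx `|t - Th 0|); lra.
  have Nrr : - r <= r by lra.
  have [|c _ <-] := IVT (v := t) Nrr (continuous_subspaceT Thc); last by exists c.
  by rewrite ge_min lo le_max hi orbT.
have [tau tauP] := choice surj.
have ThK u : tau (Th u) = u.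
  by apply/eqP; rewrite eq_le !leNgt; apply/andP; split; apply/negP => /mono;
    rewrite tauP ltxx.
have lt_tau (t u : R) : (u < tau t) = (Th u < t).
  apply/idP/idP => [/mono|]; first by rewrite tauP.
  apply: contraTT; rewrite -!leNgt le_eqVlt => /predU1P[<-|/mono].
    by rewrite tauP.
  by rewrite tauP => /ltW.
have tau_lt (t u : R) : (tau t < u) = (t < Th u).
  apply/idP/idP => [/mono|]; first by rewrite tauP.
  apply: contraTT; rewrite -!leNgt le_eqVlt => /predU1P[->|/mono].
    by rewrite tauP.
  by rewrite tauP => /ltW.
exists tau; split.
- move=> t; rewrite -{1}(tauP t); apply: (is_derive_inverse (f := Th)).
  + by near=> u; exact: ThK.
  + by near=> u; exact: Thc.
  + by rewrite gt_eqF// (lt_le_trans d0).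
- apply/cvgrNyPlt => A; exists (Th A); split; first exact: num_real.
  by move=> t /= tA; rewrite tau_lt.
- apply/cvgryPgt => A; exists (Th A); split; first exact: num_real.
  by move=> t /= tA; rewrite lt_tau.
Unshelve. all: by end_near. Qed.

Definition logistic {R : realType} (u : R) : R := (1 + expR (- u))^-1.

Lemma logistic_gt0 (R : realType) (u : R) : 0 < logistic u.
Proof. by rewrite invr_gt0 ltr_wpDr ?expR_ge0. Qed.

Lemma logistic_lt1 (R : realType) (u : R) : logistic u < 1.
Proof. by rewrite invf_lt1 ?ltrDl ?expR_gt0// ltr_wpDr ?expR_ge0. Qed.

Lemma is_derive_expRN (R : realType) (u : R) :
  is_derive u 1 (fun v : R => 1 + expR (- v)) (- expR (- u)).
Proof.
apply: (is_derive_eq (is_deriveD (is_derive_cst (1 : R) u 1)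
  (is_derive1_comp (is_derive_expR (- u)) (is_deriveNid u 1)))).
by rewrite add0r mulrN1.
Qed.

Lemma is_derive_logistic (R : realType) (u : R) :
  is_derive u 1 (@logistic R) (logistic u * (1 - logistic u)).
Proof.
have e0 := expR_gt0 (- u).
apply: (is_derive_eq (is_deriveV _ (is_derive_expRN u))); first by lra.
by rewrite /logistic /GRing.scale/=; field; lra.
Qed.

Lemma is_derive_ln_expRN (R : realType) (u : R) :
  is_derive u 1 (fun v : R => ln (1 + expR (- v))) (logistic u - 1).
Proof.
have e0 := expR_gt0 (- u).
have e1 : 0 < 1 + expR (- u) by lra.
apply: (is_derive_eq (is_derive1_comp (g := fun v : R => 1 + expR (- v))
  (is_derive1_ln e1) (is_derive_expRN u))).
by rewrite /logistic; field; lra.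
Qed.

Lemma cvg_logisticy (R : realType) : @logistic R u @[u --> +oo] --> (1 : R).
Proof.
have -> : 1 = (1 + 0 : R)^-1 by rewrite addr0 invr1.
apply: cvgV; first by rewrite addr0 oner_neq0.
by apply: cvgD; [exact: cvg_cst | exact: cvgr_expR].
Qed.

Lemma logisticN (R : realType) (u : R) : logistic (- u) = 1 - logistic u.
Proof.
have e0 := expR_gt0 u.
by rewrite /logistic opprK expRN; field; lra.
Qed.

Lemma cvg_logisticNy (R : realType) : @logistic R u @[u --> -oo] --> (0 : R).
Proof.
have lim1 : 1 - logistic u @[u --> +oo] --> (0 : R).
  have -> : 0 = (1 - 1 : R) by rewrite subrr.
  by apply: cvgB; [exact: cvg_cst | exact: cvg_logisticy].
apply: (cvgNy_compNP (@logistic R) (nbhs (0 : R))).2.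
rewrite (_ : _ \o _ = fun u : R => 1 - logistic u)//.
by apply/funext => u /=; rewrite logisticN.
Qed.

(** Separation of variables for [x' = (x - a) * (b - x) / r x]. The reciprocal of
    the speed is [A / (x - a) + B / (b - x)] plus the derivative of [K], so that
    the time spent is [A * ln (x - a) - B * ln (b - x) + K x]. In the coordinate
    [u = ln ((x - a) / (b - x))], whose inverse is an affine image of the logistic
    function, the singularities at [a] and [b] go to infinity and the time is a
    function on the whole line with rate [r x / (b - a)], to which [inverse_clock]
    applies. *)
Lemma heteroclinic_orbit (R : realType) (a b d A B : R) (r K : R -> R) :
  a < b -> 0 < d -> (forall x, a < x < b -> d <= r x) ->
  (forall x : R, a < x < b ->
    is_derive x 1 K
      ((r x - A * (b - x) - B * (x - a)) / ((x - a) * (b - x)))) ->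
  exists x : R -> R,
    [/\ forall t, a < x t < b,
        forall t : R, is_derive t 1 x ((x t - a) * (b - x t) / r (x t)),
        x t @[t --> -oo] --> a & x t @[t --> +oo] --> b].
Proof.
move=> ab d0 rd Kd.
have ba0 : 0 < b - a by rewrite subr_gt0.
pose w (u : R) := a + (b - a) * logistic u.
have wab u : a < w u < b.
  have := logistic_gt0 u; have := logistic_lt1 u; rewrite /w => l1 l0.
  by apply/andP; split; nra.
have wd (u : R) : is_derive u 1 w ((w u - a) * (b - w u) / (b - a)).
  apply: (is_derive_eq (is_deriveD (is_derive_cst a u 1)
    (is_deriveZ (b - a) (is_derive_logistic u)))).
  by rewrite /w /GRing.scale/=; field; lra.
(* [A * ln (x - a) - B * ln (b - x) + K x] in terms of [u], up to a constant. *)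
pose Th (u : R) := B * u + (B - A) * ln (1 + expR (- u)) + K (w u).
have Thd (u : R) : is_derive u 1 Th (r (w u) / (b - a)).
  apply: (is_derive_eq (is_deriveD (is_deriveD
    (is_deriveZ B (is_derive_id u 1))
    (is_deriveZ (B - A) (is_derive_ln_expRN u)))
    (is_derive1_comp (Kd _ (wab u)) (wd u)))).
  have /andP[aw wb] := wab u.
  have -> : logistic u = (w u - a) / (b - a) by rewrite /w; field; lra.
  by rewrite /GRing.scale/=; field; lra.
have [||tau [taud tauNy tauy]] := inverse_clock (d := d / (b - a)) _ Thd.
- by rewrite divr_gt0.
- by move=> u; rewrite ler_pM2r ?invr_gt0// rd.
have wcvg (F : set_system R) (l : R) : Filter F ->
    logistic u @[u --> F] --> l -> w u @[u --> F] --> a + (b - a) * l.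
  by move=> FF Fl; apply: cvgD; [exact: cvg_cst | exact: cvgMr].
exists (w \o tau); split.
- by move=> t; exact: wab.
- move=> t; apply: (is_derive_eq (is_derive1_comp (wd (tau t)) (taud t))).
  have rne : r (w (tau t)) != 0.
    by rewrite gt_eqF// (lt_le_trans d0)// rd.
  by rewrite /=; field; rewrite rne; lra.
- apply: (cvg_comp _ _ tauNy).
  have -> : a = a + (b - a) * 0 by ring.
  by apply: wcvg; exact: cvg_logisticNy.
- apply: (cvg_comp _ _ tauy).
  have -> : b = a + (b - a) * 1 by ring.
  by apply: wcvg; exact: cvg_logisticy.
Qed.

Section LineOrbit.
Context {R : realType}.

(** The speed along the line vanishes at [s] and [m], and the remaining factor
    of its numerator is affine in the position, with the values [tangency n s m]
    and [tangency n m s] at the two ends. It is therefore positive in between, and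
    partial fractions give the time as a sum of three logarithms. *)
Lemma line_orbit (n s m : R) : 0 < n -> 0 <= s -> s < m -> m <= 1 ->
  0 < tangency n s m ->
  exists x : R -> R,
    [/\ forall t, s < x t < m,
        forall t : R, is_derive t 1 x
          (eff_flux n (x t) - eff_flux n s - chord n s m * (x t - s)),
        x t @[t --> -oo] --> s & x t @[t --> +oo] --> m].
Proof.
move=> n0 s0 sm m1 Ts0.
have Tm0 : 0 < tangency n m s by apply: lt_le_trans Ts0 _; apply: tangency_swap; lra.
(* The third factor of the numerator of the speed. *)
pose T x := (1 + n) * (s + m - 2 * s * m) * x + ((1 + n) * (s * m) - n).
pose t1 := (1 + n) * (s + m - 2 * s * m).
have Tms (x : R) : T m - T x = t1 * (m - x) by rewrite /T /t1; ring.
have TsE : T s = tangency n s m by rewrite /T /tangency; ring.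
have TmE : T m = tangency n m s by rewrite /T /tangency; ring.
have q0 : 0 < s + m - 2 * s * m by nra.
have t10 : 0 < t1 by rewrite mulr_gt0// addr_gt0.
have Tx0 x : s < x -> 0 < T x.
  move=> sx; apply: (@lt_trans _ _ (T s)); first by rewrite TsE.
  have TB : T x - T s = t1 * (x - s) by rewrite /T /t1; ring.
  by rewrite -subr_gt0 TB mulr_gt0// subr_gt0.
have E0 x := Efun_gt0 x n0.
pose k := n / (Efun n s * Efun n m).
have k0 : 0 < k by rewrite divr_gt0 ?mulr_gt0.
pose r x := Efun n x / (k * T x).
have T0s : 0 < T s by rewrite TsE.
have T0m : 0 < T m by rewrite TmE.
(* The coefficient of the partial fraction with denominator [T x], read off from
   the terms in [x ^+ 2]. *)
pose c := - ((1 + n) + t1 * (Efun n s / T s - Efun n m / T m) / (m - s)).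
pose K := (c / (k * t1)) *: (@ln R \o T).
have Td (x : R) : is_derive x 1 T t1.
  apply: (is_derive_eq (is_deriveD (is_deriveZ t1 (is_derive_id x (1 : R)))
    (is_derive_cst _ x (1 : R)))).
  by rewrite /GRing.scale/=; ring.
(* [A] and [B] are the values that cancel the singularities at [s] and [m]; the
   lower bound of [r] combines the minimum of [Efun n] with the maximum [T m] of
   the increasing function [T]. *)
have [|||x [xI xd xNy xy]] := @heteroclinic_orbit R s m (n / (1 + n) / (k * T m))
    (r s / (m - s)) (r m / (m - s)) r K sm.
- by apply: divr_gt0; [rewrite divr_gt0 ?addr_gt0 | rewrite mulr_gt0].
- move=> x /andP[sx xm].
  rewrite /r; apply: ler_pM; first by rewrite divr_ge0 ?addr_ge0 ?ltW.
  - by rewrite invr_ge0 mulr_ge0 ?ltW.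
  - exact: Efun_ge.
  have TxTm : T x <= T m by rewrite -subr_ge0 Tms mulr_ge0 ?ltW ?subr_gt0.
  have kT y : 0 < T y -> 0 < k * T y by exact: mulr_gt0.
  by rewrite lef_pV2 ?posrE ?kT ?Tx0// ler_pM2l.
- move=> x /andP[sx xm]; have Txx := Tx0 _ sx.
  apply: (is_derive_eq (is_deriveZ _ (is_derive1_comp (is_derive1_ln Txx) (Td x)))).
  rewrite /GRing.scale/= /r /c.
  have := E0 s; have := E0 m; move: Txx T0s T0m t10 k0; rewrite /T /t1; clearbody k.
  rewrite /Efun => *; field.
  by rewrite ?gt_eqF//; lra.
- exists x; split=> // t; apply: is_derive_eq (xd t) _.
  have /andP[/Tx0 Txx _] := xI t.
  have := E0 s; have := E0 m; have := E0 (x t); move: Txx.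
  rewrite /r /k /T /eff_flux /chord /Efun => *; field.
  by rewrite ?gt_eqF//; lra.
Qed.

End LineOrbit.

(** * Undercompressive shocks *)

Section Shock.
Context {R : realType}.
Implicit Types (mu : phase -> R) (U V : 'rV[R]_2) (G i : phase).

Lemma is_derive_line_state mu G (x : R -> R) (t dx : R) :
  is_derive t 1 x dx ->
  is_derive t 1 (fun u => line_state mu G (x u))
    (dx *: (edge_point mu G - vertex mu G)).
Proof.
move=> [xd xE]; pose dir := edge_point mu G - vertex mu G.
have xdf : differentiable x t by exact/derivable1_diffP.
have dird : is_derive t 1 (fun u => x u *: dir) (dx *: dir).
  apply: DeriveDef; first exact/diff_derivable/differentiableZl.
  by rewrite deriveE ?diffZl -?deriveE ?xE//; exact: differentiableZl.
rewrite (_ : (fun u => _) = cst (vertex mu G) + (fun u => x u *: dir)).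
  by apply: is_derive_eq (is_deriveD (is_derive_cst _ t (1 : R)) dird) _; rewrite add0r.
by apply/funext => u; rewrite line_state_affine.
Qed.

Lemma cvg_line_state mu G (x : R -> R) (F : set_system R) (l : R) : Filter F ->
  x t @[t --> F] --> l -> line_state mu G (x t) @[t --> F] --> line_state mu G l.
Proof.
move=> FF xl; rewrite (line_state_affine mu G l).
under eq_fun do rewrite line_state_affine.
by apply: cvgD; [exact: cvg_cst | exact: cvgZr_tmp].
Qed.

(** Every ingredient reduces to the scalar flux. On the left the transverse speed
    is the slow one and on the right it is the fast one, so that both states are
    saddles and the profile, which stays on the line, joins the unstable
    direction of the first to the stable direction of the second. *)
Lemma line_shock mu G (s m : R) : (forall i, 0 < mu i) -> nu mu G <= 1 ->
  0 <= s -> s < slow_sat (nu mu G) m -> 2^-1 <= m <= 1 ->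
  0 < tangency (nu mu G) s m ->
  undercompressive_shock mu (line_state mu G s) (line_state mu G m)
    (chord (nu mu G) s m).
Proof.
move=> mu0; have := nu_gt0 G mu0; set n := nu mu G => n0 n1 s0 s_slow m12 Ts0.
have /andP[m1 m2] := m12.
have /andP[_ slow_le] := slow_sat_le n0 n1 m12.
have n2 : n / (1 + n) <= 2^-1 by rewrite ler_pdivrMr ?addr_gt0//; lra.
have s12 : s < 2^-1 by lra.
have sm : s < m by lra.
have Tm0 : 0 < tangency n m s by apply: lt_le_trans Ts0 _; apply: tangency_swap; lra.
have inside v : s <= v <= m -> Omega (line_state mu G v).
  by move=> v_bd; apply: Omega_line_state => //; lra.
have jump u v : flux mu (line_state mu G v) - flux mu (line_state mu G u) =
    (eff_flux n v - eff_flux n u) *: (edge_point mu G - vertex mu G).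
  by rewrite !flux_line_state// line_state_affine [in X in _ - X]line_state_affine
    opprD addrACA subrr add0r -scalerBl.
have disp u v : line_state mu G v - line_state mu G u =
    (v - u) *: (edge_point mu G - vertex mu G).
  by rewrite line_state_affine [in X in _ - X]line_state_affine
    opprD addrACA subrr add0r -scalerBl.
split.
- by apply: inside; rewrite lexx ltW.
- by apply: inside; rewrite lexx ltW.
- move=> /(congr1 (eff_sat G)); rewrite !eff_sat_line_state// => sE.
  by move: sm; rewrite sE ltxx.
- by rewrite jump disp eff_fluxB// scalerA.
- have [-> ->] := lambda_line_state G s mu0.
  rewrite gt_min lt_max; apply/andP; split; apply/orP; [left|right].
    exact: lam_trans_lt_chord.
  exact: chord_lt_lam_line.
- have [-> ->] := lambda_line_state G m mu0.
  rewrite gt_min lt_max; apply/andP; split; apply/orP; [right|left].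
    exact: lam_line_lt_chord.
  exact: chord_lt_lam_trans.
- have [x [xI xd xNy xy]] := line_orbit n0 s0 sm m2 Ts0.
  exists (fun t => line_state mu G (x t)); split.
  + by move=> t; apply: inside; have /andP[? ?] := xI t; rewrite !ltW.
  + move=> t; apply: is_derive_eq (is_derive_line_state mu G (xd t)) _.
    by rewrite jump disp scalerA -scalerBl.
  + exact: cvg_line_state.
  + exact: cvg_line_state.
Qed.

End Shock.

Theorem theorem5p2 (R : realType) (mu : phase -> R)
    (mu_gt0 : forall i : phase, 0 < mu i)
    (G : phase) (nu_le1 : nu mu G <= 1)
    (M : 'rV[R]_2)
    (M_seg : line_segment mu G (umbilic_ext mu G) (edge_point mu G) M) :
  exists S F : 'rV[R]_2,
    [/\ line_segment mu G (vertex mu G) (umbilic mu) S,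
        line_segment mu G (vertex mu G) (umbilic mu) F,
        forall U : 'rV[R]_2, invariant_line mu G U ->
          eff_sat G F < eff_sat G U < eff_sat G S ->
          undercompressive_shock mu U M (sigma mu G U M),
        sigma mu G S M = lambda_s mu S
      & sigma mu G F M = lambda_f mu F].
Proof.
have n0 := nu_gt0 G mu_gt0.
case: M_seg => lineM; rewrite /umbilic_ext /edge_point !eff_sat_line_state// => m12.
set m := eff_sat G M in m12.
have ME : line_state mu G m = M by exact: line_state_eff_sat.
have slow_bd := slow_sat_le n0 nu_le1 m12.
have [fast fast_bd Tfast] := fast_sat_exists n0 nu_le1 m12.
have /andP[m1 m2] := m12; have /andP[slow0 slow_le] := slow_bd.
have /andP[fast0 fast_le] := fast_bd.
have u1 : nu mu G / (1 + nu mu G) <= 1.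
  by rewrite ler_pdivrMr ?addr_gt0// mul1r lerDr.
have seg s : 0 <= s <= nu mu G / (1 + nu mu G) ->
    line_segment mu G (vertex mu G) (umbilic mu) (line_state mu G s).
  move=> s_bd; split; first by apply: invariant_line_state => //; lra.
  by rewrite !eff_sat_line_state// eff_sat_umbilic.
have sigmaE s : sigma mu G (line_state mu G s) M = chord (nu mu G) s m.
  by rewrite /sigma eff_sat_line_state.
exists (line_state mu G (slow_sat (nu mu G) m)), (line_state mu G fast).
split; [exact: seg | exact: seg | | |].
- move=> U lineU; rewrite !eff_sat_line_state// => /andP[sF sS].
  rewrite -(line_state_eff_sat mu_gt0 lineU) sigmaE -ME.
  apply: line_shock => //; first by lra.
  by rewrite -Tfast; apply: tangency_mono => //; lra.
- rewrite sigmaE (lambda_line_state G _ mu_gt0).1 min_l ?lam_trans_le_line//.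
  by apply/eqP; rewrite -subr_eq0 chord_lam_trans// subrr !mul0r.
- rewrite sigmaE (lambda_line_state G _ mu_gt0).2 max_r ?lam_trans_le_line//.
  by apply/eqP; rewrite eq_sym -subr_eq0 lam_line_chord// Tfast mulr0 mul0r.
Qed.
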